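(* Let $\pi=1^{a_1}2^{a_2}\cdots l^{a_l}\in[l]^m$ $(l>1)$ be a nonconstant monotone generalized pattern without hyphens. If there exists a positive integer $j\le l-2$ such that $a_1\le a_{j+1}$, $a_i=a_{i+j}$ for all $2\le i\le l-j-1$, and $a_{l-j}\ge a_l$, then denote by $j_0$ the least such $j$ and define $M_\pi=a_2+\dots+a_{j_0+1}$. Otherwise set $M_\pi=\max\{a_1,a_l\}+a_2+\dots+a_{l-1}$. In either case $\delta(\pi)=\delta'(\pi)=1/M_\pi$.
   Context: $[k]=\{1,\dots,k\}$ and $[k]^n$ is the set of words of length $n$ over $[k]$. For a letter $a$ and an integer $j\ge1$, $a^j$ is the word $a\cdots a$ ($j$ copies); so all $a_i\ge1$. Two words $u,v$ of the same length are order-isomorphic if for all positions $i,j$: $u_i<u_j\iff v_i<v_j$. An occurrence of a generalized pattern $\pi$ of length $m$ without hyphens in a word $\sigma=\sigma_1\cdots\sigma_n$ is a factor of $m$ consecutive letters $\sigma_i\sigma_{i+1}\cdots\sigma_{i+m-1}$ order-isomorphic to $\pi$; $\nu(\pi,\sigma)$ is the number of occurrences. Such a pattern has one block, and for $n\ge m$ one sets $\delta(\pi,k,n)=\max\{\nu(\pi,\sigma):\sigma\in[k]^n\}/(n-m+1)$. Then $\delta(\pi)=\lim_{n\to\infty}\lim_{k\to\infty}\delta(\pi,k,n)=\lim_{n\to\infty}\delta(\pi,n,n)$ (for $k\ge n$, $\delta(\pi,k,n)=\delta(\pi,n,n)$) and $\delta'(\pi)=\lim_{k\to\infty}\lim_{n\to\infty}\delta(\pi,k,n)$.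 *)

(* Defs.v *)
From mathcomp Require Import all_boot all_order all_algebra.
From mathcomp Require Import all_classical all_reals all_analysis.

Set Implicit Arguments.
Unset Strict Implicit.
Unset Printing Implicit Defensive.

Import Order.TTheory GRing.Theory Num.Theory.
Import numFieldNormedType.Exports.

Local Open Scope ring_scope.
Local Open Scope classical_set_scope.

Definition order_iso (u v : seq nat) : bool :=
  (size u == size v) &&
  [forall i : 'I_(size u), forall j : 'I_(size u),
     (nth 0%N u i < nth 0%N u j)%N == (nth 0%N v i < nth 0%N v j)%N].

(* If size s < size pi, the only candidate factor tested is s itself, which is
   rejected by the size test of order_iso, so the count is 0. *)
Definition nu (pi s : seq nat) : nat :=
  count (fun i => order_iso (take (size pi) (drop i s)) pi)
        (iota 0 (size s - size pi).+1).

(* The alphabet [k] is represented by 'I_k = {0, .., k-1}: only the relative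
   order of letters matters.  Truncated subtraction and 0^-1 = 0 make this 0
   when n < size pi, where the mathematical quantity is not defined. *)
Definition delta_kn (R : realType) (pi : seq nat) (k n : nat) : R :=
  (\max_(s : n.-tuple 'I_k) nu pi (map val s))%:R / (n.+1 - size pi)%:R.

Definition iterated_cvg (R : realType) (u : nat -> nat -> R) : Prop :=
  (forall i, cvgn (u i)) /\ cvgn (fun i => limn (u i)).

Definition iterated_lim (R : realType) (u : nat -> nat -> R) : R :=
  limn (fun i => limn (u i)).

(* delta: k tends to infinity first, then n;
   delta': n tends to infinity first, then k. *)
Definition delta_exists (R : realType) (pi : seq nat) : Prop :=
  iterated_cvg (fun n k => delta_kn R pi k n).

Definition delta (R : realType) (pi : seq nat) : R :=
  iterated_lim (fun n k => delta_kn R pi k n).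

Definition delta'_exists (R : realType) (pi : seq nat) : Prop :=
  iterated_cvg (fun k n => delta_kn R pi k n).

Definition delta' (R : realType) (pi : seq nat) : R :=
  iterated_lim (fun k n => delta_kn R pi k n).

(* The word 1^(a 1) 2^(a 2) ... l^(a l); only a 1, ..., a l matter. *)
Definition monotone_pattern (l : nat) (a : nat -> nat) : seq nat :=
  flatten [seq nseq (a i) i | i <- iota 1 l].

Definition admissible_shift (l : nat) (a : nat -> nat) (j : nat) : bool :=
  [&& (1 <= j)%N, (j <= l - 2)%N, (a 1 <= a j.+1)%N,
      all (fun i => a i == a (i + j)%N) (index_iota 2 (l - j))
    & (a l <= a (l - j))%N].

(* The filtered list is increasing, so its head is the least admissible j. *)
Definition M_pattern (l : nat) (a : nat -> nat) : nat :=
  if [seq j <- iota 1 (l - 2) | admissible_shift l a j] is j0 :: _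
  then (\sum_(2 <= i < j0.+2) a i)%N
  else (maxn (a 1) (a l) + \sum_(2 <= i < l) a i)%N.

(* Main.v *)
Require Import Defs.
From mathcomp Require Import all_boot all_order all_algebra.
From mathcomp Require Import all_classical all_reals all_analysis.
From mathcomp Require Import zify ring lra.

(** M is the smallest possible distance between two occurrences of the pattern
    in a word.  If two occurrences at distance d overlap in more than one run,
    their run boundaries coincide on the overlap, which forces
    [d = a 2 + ... + a j.+1] for a shift j that satisfies exactly the conditions of
    [admissible_shift]; otherwise they share at most one run, and a shared run is as
    long as both [a 1] and [a l] ([M_pattern_le_shift], [occ_spaced]).
    Hence a word of length n has at most about n / M occurrences ([maxnu_upper]).
    Conversely, the distance M can be repeated for ever: there are periodic run
    lengths, with M letters per period, that contain those of the pattern once in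
    each period ([periodic_runs]).  The nondecreasing word with these runs has about
    n / M occurrences and uses at most n letters ([maxnu_lower]).

    This settles the limit in which the alphabet grows first.  For a fixed
    alphabet of size k such a word is limited to k runs, but the maximal number of
    occurrences is superadditive in the length ([maxnu_superadd]), since words can
    be concatenated.  By Fekete's lemma its slope converges as n grows, to a limit
    that is at least the slope at any given length, in particular at length k-1,
    where the previous construction is available.  So both iterated limits are
    squeezed to 1 / M ([iterated_density]). *)

Import Order.TTheory GRing.Theory Num.Theory.
Import numFieldNormedType.Exports.

(** * Run lengths and monotone words *)

Definition psum (a : nat -> nat) (i : nat) : nat := \sum_(1 <= u < i.+1) a u.

Lemma psum0 a : psum a 0 = 0.
Proof. by rewrite /psum big_geq. Qed.

Lemma psumS a i : psum a i.+1 = psum a i + a i.+1.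
Proof. by rewrite /psum big_nat_recr. Qed.

Lemma psum1 a : psum a 1 = a 1.
Proof. by rewrite psumS psum0. Qed.

Lemma leq_psum a : {homo psum a : i j / i <= j}.
Proof. by apply: homo_leq => // [k i j|i]; [exact: leq_trans | rewrite psumS leq_addr]. Qed.

Lemma psum_sum a j : 0 < j -> psum a j = a 1 + \sum_(2 <= i < j.+1) a i.
Proof. by move=> j0; rewrite /psum big_ltn. Qed.

(** Positivity is only assumed of the entries that the pattern reads, since the
    run lengths beyond index l are arbitrary. *)
Definition positive_upto (l : nat) (a : nat -> nat) : Prop :=
  forall i, 1 <= i <= l -> 1 <= a i.

Lemma ltn_psum l a i j : positive_upto l a -> i <= l -> j <= l ->
  (psum a i < psum a j) = (i < j).
Proof.
move=> ha il jl; case: (ltnP i j) => ij; last first.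
  by apply/negbTE; rewrite -leqNgt leq_psum.
apply: leq_trans (leq_psum a _ _ ij).
by rewrite psumS; have := ha i.+1; lia.
Qed.

Lemma psum_ge l a i : positive_upto l a -> i <= l -> i <= psum a i.
Proof.
move=> ha; elim: i => // i IH il; rewrite psumS.
have := ha i.+1; have := IH (ltnW il); lia.
Qed.

Lemma psum_level l a t : t < psum a l ->
  exists i, [/\ i < l, psum a i <= t & t < psum a i.+1].
Proof.
elim: l => [|l IH]; first by rewrite psum0.
case: (ltnP t (psum a l)) => [/IH[i [il h1 h2]] _|h1 h2].
  by exists i; split=> //; rewrite ltnW.
by exists l.
Qed.

Lemma monotone_patternS l a :
  monotone_pattern l.+1 a = monotone_pattern l a ++ nseq (a l.+1) l.+1.
Proof.
by rewrite /monotone_pattern -[in LHS](addn1 l) iotaD map_cat flatten_cat /= cats0 add1n.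
Qed.

Lemma size_monotone_pattern l a : size (monotone_pattern l a) = psum a l.
Proof.
elim: l => [|l IH]; first by rewrite psum0.
by rewrite monotone_patternS size_cat size_nseq IH psumS.
Qed.

Lemma size_monotone_pattern_gt0 l a : 0 < l -> positive_upto l a ->
  0 < size (monotone_pattern l a).
Proof.
move=> l0 ha; rewrite size_monotone_pattern.
exact: leq_trans (psum_ge l a l ha (leqnn l)).
Qed.

(** Run i counted from 0 occupies the positions from [psum a i] on; the letters
    of the pattern count the runs from 1, hence the successor. *)
Lemma nth_monotone_pattern l a i t : i < l -> psum a i <= t -> t < psum a i.+1 ->
  nth 0 (monotone_pattern l a) t = i.+1.
Proof.
elim: l => // l IH il h1 h2.
rewrite monotone_patternS nth_cat size_monotone_pattern.
case: (ltnP i l) => [ij|li].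
  by rewrite (leq_trans h2) ?leq_psum // IH.
have -> : i = l by lia.
have -> : t < psum a l = false.
  by apply/negbTE; rewrite -leqNgt (leq_trans _ h1)// leq_psum.
rewrite nth_nseq.
have -> // : t - psum a l < a l.+1.
have -> : l = i by lia.
by move: h1 h2; rewrite psumS; lia.
Qed.

(** * Two occurrences are at least M apart *)

(** The two ends 0 and [psum a l] are left out: no ascent of the pattern is
    visible there, so an occurrence says nothing about them. *)
Definition run_boundary (l : nat) (a : nat -> nat) (x : nat) : Prop :=
  exists i, [/\ 0 < i, i < l & x = psum a i].

(** Ascents are what two overlapping occurrences can be compared on: an
    occurrence copies the ascents of the pattern into the word. *)
Lemma ascentP l a x : positive_upto l a -> 0 < x -> x < psum a l ->
  nth 0 (monotone_pattern l a) x.-1 < nth 0 (monotone_pattern l a) x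
  <-> run_boundary l a x.
Proof.
move=> ha x0 xl; have [i [il h1 h2]] := psum_level _ _ _ xl.
rewrite (nth_monotone_pattern _ _ i x)//.
case: (eqVneq x (psum a i)) => [xi|nxi].
  split=> [_|_].
    exists i; split=> //; case: i {il h1 h2} xi => // xi.
    by move: x0; rewrite xi psum0.
  case: i il h1 h2 xi => [|i] il h1 h2 xi; first by move: x0; rewrite xi psum0.
  have := ltn_psum l a i i.+1 ha; rewrite ltnSn => h.
  rewrite (nth_monotone_pattern _ _ i)//; [lia| |]; rewrite xi; last first.
    by move: x0; rewrite xi; lia.
  by have := h (ltnW (ltnW il)) (ltnW il); lia.
rewrite (nth_monotone_pattern _ _ i)//; [|lia|lia].
rewrite ltnn; split=> // -[u [u0 ul xu]].
have iu : i < u by rewrite -(ltn_psum l a)//; [lia|lia|exact: ltnW].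
have ui : u < i.+1 by rewrite -(ltn_psum l a)//; [lia|exact: ltnW].
lia.
Qed.

(** The trace left on the pattern by two occurrences at distance d: on the
    overlap they see the same letters, hence the same ascents. *)
Definition overlap_agrees (l : nat) (a : nat -> nat) (d : nat) : Prop :=
  forall x, d < x < psum a l ->
    (run_boundary l a x <-> run_boundary l a (x - d)).

(** The boundary between the first two runs of the later occurrence falls inside
    the earlier one, so it is also one of the boundaries of the latter, say the
    one after run j+1.  From there on both occurrences enumerate the same
    boundaries in increasing order, so run i of the later one is run i+j of the
    earlier one.  Only the extreme runs may differ: the first run of the later
    occurrence is a suffix of run j+1 of the earlier one, and the last run of the
    earlier occurrence is a prefix of run l-j of the later one. *)
Lemma overlap_admissible l a d : 1 < l -> positive_upto l a -> 0 < d ->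
  overlap_agrees l a d -> d + a 1 < psum a l ->
  exists j, admissible_shift l a j /\ d + a 1 = psum a j.+1.
Proof.
move=> l_gt1 a_pos d_gt0 boundary_shift hd.
have ltp i j : i <= l -> j <= l -> (psum a i < psum a j) = (i < j).
  exact: ltn_psum.
have a1 : 0 < a 1 by apply: a_pos; lia.
have bnd i : 0 < i -> i < l -> d + psum a i < psum a l -> run_boundary l a (d + psum a i).
  move=> i0 il h; apply/boundary_shift.
    by rewrite h andbT; have := psum_ge l a i a_pos (ltnW il); lia.
  by rewrite addKn; exists i.
have bnd' i : i < l -> d < psum a i -> run_boundary l a (psum a i - d).
  move=> il h; apply: (proj1 (boundary_shift (psum a i) _)); first by rewrite h ltp // ltnW.
  by exists i; split => //; case: (i) h => //; rewrite psum0.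
have [v [v0 vl ev]] : run_boundary l a (d + a 1).
  by rewrite -psum1; apply: bnd; rewrite ?psum1.
have v1 : 1 < v by rewrite -ltp ?psum1; lia.
exists v.-1; set j := v.-1.
have vj : v = j.+1 by rewrite /j; lia.
have jl : 0 < j /\ j <= l - 2 by lia.
rewrite vj in ev vl; split; last exact: ev.
(* the boundaries in the overlap are matched in order, by induction on i *)
have match_ i : 0 < i -> i <= l - 1 - j -> d + psum a i = psum a (j + i).
  elim: i => // -[|i] IH _ il; first by rewrite psum1 addn1.
  have {}IH := IH isT (ltnW il).
  have up : d + psum a i.+2 <= psum a (j + i.+2).
    have [||u [u0 ul eu]] := bnd' (j + i.+2); first lia.
      by rewrite (@leq_trans (psum a (j + i.+1)).+1) ?ltnS -?IH ?leq_addr // IH ltp; lia.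
    have h : psum a (j + i.+1) < psum a (j + i.+2) by rewrite ltp; lia.
    have : psum a i.+1 < psum a u by lia.
    rewrite ltp; [|lia|lia] => /(leq_psum a); lia.
  have [|||u [u0 ul eu]] := bnd i.+2 => //; first lia.
    apply: leq_ltn_trans up _; rewrite ltp; lia.
  have h : psum a i.+1 < psum a i.+2 by rewrite ltp; lia.
  have : psum a (j + i.+1) < psum a u by lia.
  rewrite ltp; [|lia|lia]; rewrite -addnS => /(leq_psum a); lia.
apply/and5P; split.
- lia.
- lia.
- have := ev; rewrite psumS.
  have [|dj] := leqP (psum a j) d; first lia.
  have [u [u0 ul eu]] := bnd' j (ltnW vl) dj.
  have : psum a u < psum a 1.
    have : psum a j < psum a j.+1 by rewrite ltp; lia.
    by rewrite -eu psum1; lia.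
  by rewrite ltp; lia.
- apply/allP => i; rewrite mem_index_iota => /andP[i2 il].
  case: i i2 il => [|[|i]] // _ il.
  have := match_ i.+2 isT; have := match_ i.+1 isT.
  have -> : i.+2 + j = (j + i.+1).+1 by lia.
  rewrite (addnS j i.+1) (psumS a i.+1) (psumS a (j + i.+1)); lia.
- have e : l - j = (l - 1 - j).+1 by lia.
  have e' : l = (l - 1).+1 by lia.
  have m := match_ (l - 1 - j).
  rewrite subnKC in m; last lia.
  have [lt|ge] := ltnP (d + psum a (l - j)) (psum a l); last first.
    by move: ge m; rewrite e psumS -e; have := psumS a (l - 1); rewrite -e'; lia.
  have [|||u [u0 ul eu]] := bnd (l - j) => //; try lia.
  have : psum a (l - 1) < psum a u.
    rewrite -eu -m; [|lia|lia]; rewrite ltn_add2l ltp; lia.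
  by rewrite ltp; lia.
Qed.

(** Here the occurrences share at most the last run of the earlier one and the
    first run of the later one.  If they share less than the room demanded by
    [maxn], then [a 1 > a l], and the last boundary of the earlier occurrence
    would precede the first boundary of the later one while lying in its range. *)
Lemma overlap_long l a d : 1 < l -> positive_upto l a ->
  overlap_agrees l a d -> psum a l <= d + a 1 ->
  maxn (a 1) (a l) + psum a l.-1 <= d + a 1.
Proof.
move=> l_gt1 a_pos boundary_shift hd.
have e : psum a l = psum a l.-1 + a l.
  by have := psumS a l.-1; rewrite prednK; lia.
have al : 0 < a l by apply: a_pos; lia.
have [|dl] := leqP (psum a l.-1) d; first lia.
have [||u [u0 ul eu]] := proj1 (boundary_shift (psum a l.-1) _); first lia.
  by exists l.-1; split=> //; lia.
have : psum a 1 <= psum a u by apply: leq_psum.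
rewrite psum1; lia.
Qed.

Variant M_pattern_spec (l : nat) (a : nat -> nat) : nat -> Prop :=
| MLeastShift j of admissible_shift l a j
    & (forall i, admissible_shift l a i -> j <= i) :
    M_pattern_spec l a (\sum_(2 <= i < j.+2) a i)
| MNoShift of (forall j, ~~ admissible_shift l a j) :
    M_pattern_spec l a (maxn (a 1) (a l) + \sum_(2 <= i < l) a i).

Lemma M_patternP l a : M_pattern_spec l a (M_pattern l a).
Proof.
have mem j : (j \in [seq j <- iota 1 (l - 2) | admissible_shift l a j]) =
    admissible_shift l a j.
  rewrite mem_filter mem_iota; case E : admissible_shift => //=.
  by case/and5P: E; lia.
rewrite /M_pattern.
have := sorted_filter (@ltn_trans) (admissible_shift l a)
          (iota_ltn_sorted 1 (l - 2)).
case E : [seq _ <- _ | _] => [|j s] srt.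
  by apply: MNoShift => j; rewrite -mem E.
apply: MLeastShift => [|i]; first by rewrite -mem E mem_head.
rewrite -mem E inE => /orP[/eqP->//|is_]; apply: ltnW.
by have /allP := order_path_min (@ltn_trans) srt; apply.
Qed.

(** The distance is [psum a j.+1 - a 1] for an admissible j, hence smallest for the
    least j; distances that do not come from an admissible j are longer still. *)
Lemma M_pattern_le_shift l a d : 1 < l -> positive_upto l a -> 0 < d ->
  overlap_agrees l a d -> M_pattern l a <= d.
Proof.
move=> l_gt1 a_pos d_gt0 agr.
have sumE j : 0 < j -> \sum_(2 <= i < j.+1) a i + a 1 = psum a j.
  by move=> j0; rewrite psum_sum // addnC.
have [lt|ge] := ltnP (d + a 1) (psum a l).
  have [j [adm ej]] := overlap_admissible l a d l_gt1 a_pos d_gt0 agr lt.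
  case: M_patternP => [j0 _ /(_ j adm) j0j|/(_ j)]; last by rewrite adm.
  have := leq_psum a j0.+1 j.+1 j0j; rewrite -ej -sumE //; lia.
have := overlap_long l a d l_gt1 a_pos agr ge.
have lE := prednK (ltnW l_gt1).
case: M_patternP => [j0 /and5P[j0_gt0 j0l _ _ _] _|_].
  have : psum a j0.+1 <= psum a l.-1 by apply: leq_psum; lia.
  rewrite -sumE //; lia.
by rewrite -sumE ?lE; lia.
Qed.

Lemma M_pattern_gt0 l a : 1 < l -> positive_upto l a -> 0 < M_pattern l a.
Proof.
move=> l1 ha; have a1 : 0 < a 1 by apply: ha; lia.
case: M_patternP => [j /and5P[j_gt0 jl _ _ _] _|_]; last lia.
by rewrite big_ltn //; have := ha 2; lia.
Qed.

(** * Run lengths realising the distance M *)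

(** Repeating the run lengths [a 2, ..., a j.+1] of the least admissible shift
    with period j reproduces the pattern at every multiple of j: admissibility
    says that [a 2, ..., a l.-1] already has this period and that the first
    and last runs fit into the runs found at their place.  Without admissible
    shift the same works with period l-1, the first and last runs of consecutive
    occurrences sharing one run of length [maxn (a 1) (a l)]. *)
Lemma periodic_runs l a : 1 < l -> positive_upto l a ->
  exists b j, [/\ 0 < j < l, forall t, b (t + j) = b t & forall t, 0 < b t] /\
    [/\ a 1 <= b 1, forall i, 2 <= i < l -> b i = a i, a l <= b l
      & psum b j = M_pattern l a].
Proof.
move=> l1 ha.
(* c 2, ..., c j.+1 are the run lengths of one period; indexing it from 2
   keeps it aligned with a *)
suff [c [j [jl cpos cM [c1 ci cl]]]] : exists c j, [/\ 0 < j < l,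
    forall i, 2 <= i < j + 2 -> 0 < c i, \sum_(2 <= i < j.+2) c i = M_pattern l a &
    [/\ a 1 <= c j.+1, forall i, 2 <= i < l -> a i = c (2 + (i - 2) %% j)
      & a l <= c (2 + (l - 2) %% j)]].
  have [j0 jl'] := andP jl.
  (* adding 2 * (j - 1) stands for subtracting 2 modulo j *)
  pose b t := c (2 + (t + (j.-1).*2) %% j).
  have bE t : 2 <= t -> b t = c (2 + (t - 2) %% j).
    by move=> t2; rewrite /b (_ : t + _ = 2 * j + (t - 2)) ?modnMDl //; lia.
  have b1 : b 1 = c j.+1.
    rewrite /b (_ : 1 + _ = 1 * j + j.-1) ?modnMDl ?modn_small //; try lia.
    by rewrite (_ : 2 + j.-1 = j.+1) //; lia.
  exists b, j; split; split=> //.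
  - by move=> t; rewrite /b addnAC modnDr.
  - by move=> t; rewrite /b; apply: cpos; rewrite leq_addr addnC ltn_add2r ltn_pmod.
  - by rewrite b1.
  - by move=> i il; rewrite bE ?ci //; lia.
  - by rewrite bE.
  - rewrite psum_sum // b1 -cM [RHS]big_nat_recr //= addnC; congr (_ + _).
    rewrite big_nat [RHS]big_nat; apply: eq_bigr => i /andP[i2 ij].
    by rewrite bE // modn_small; [congr c|]; lia.
case: M_patternP => [j /and5P[j0 jl a1 /allP aj al] _|_]; last first.
  exists (fun i => if i < l then a i else maxn (a 1) (a l)), l.-1; split.
  - lia.
  - move=> i il; case: (ltnP i l) => il'; first by apply: ha; lia.
    have : 0 < a 1 by [apply: ha; lia]; lia.
  - rewrite prednK; last lia.
    rewrite big_nat_recr /=; last lia.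
    rewrite ltnn addnC; congr (_ + _).
    by rewrite big_nat [RHS]big_nat; apply: eq_bigr => i /andP[_ ->].
  - split.
    + by rewrite prednK ?ltnn ?leq_maxl //; lia.
    + move=> i /andP[i2 il]; rewrite modn_small; last lia.
      by rewrite (_ : 2 + (i - 2) = i) ?il //; lia.
    + rewrite modn_small; last lia.
      by rewrite (_ : 2 + (l - 2) = l) ?ltnn ?leq_maxr //; lia.
have per i : 2 <= i < l -> a i = a (2 + (i - 2) %% j).
  elim/ltn_ind: i => i IH il.
  have [ij|ji] := ltnP i (j + 2).
    by rewrite modn_small; [congr a|]; lia.
  have -> : i = (i - j) + j by lia.
  rewrite -(eqP (aj (i - j) _)); last by rewrite mem_index_iota; lia.
  rewrite IH; [|lia|lia].
  by rewrite -(modnDr (i - j - 2)); congr (a (2 + _ %% _)); lia.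
exists a, j; split=> //.
- lia.
- by move=> i ij; apply: ha; lia.
- split=> //; apply: leq_trans al _; rewrite per; last lia.
  rewrite -(modnDr (l - j - 2)) (_ : l - j - 2 + j = l - 2) //; lia.
Qed.

(** * Counting occurrences *)

Definition occ (pi s : seq nat) (p : nat) : bool :=
  order_iso (take (size pi) (drop p s)) pi.

Lemma occP pi s p : 0 < size pi -> reflect
  (p + size pi <= size s /\ forall i j, i < size pi -> j < size pi ->
    (nth 0 s (p + i) < nth 0 s (p + j)) = (nth 0 pi i < nth 0 pi j))
  (occ pi s p).
Proof.
move=> pi0; rewrite /occ /order_iso.
have sz : (size (take (size pi) (drop p s)) == size pi) = (p + size pi <= size s).
  by rewrite size_take_min size_drop; apply/eqP/idP; lia.
apply: (iffP andP) => [[/eqP e /forallP h]|[e h]].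
  have pe : p + size pi <= size s by rewrite -sz e.
  split=> // i j ilt jlt.
  have h' i' : i' < size pi -> i' < size (take (size pi) (drop p s)) by rewrite e.
  have /forallP/(_ (Ordinal (h' _ jlt)))/eqP := h (Ordinal (h' _ ilt)).
  by rewrite /= !nth_take // !nth_drop.
split; first by rewrite sz.
have /eqP e' : size (take (size pi) (drop p s)) == size pi by rewrite sz.
apply/forallP => i; apply/forallP => j.
have il : i < size pi by rewrite -[X in _ < X]e'.
have jl : j < size pi by rewrite -[X in _ < X]e'.
by rewrite !nth_take // !nth_drop h.
Qed.

(** Positions too close to the end carry no occurrence, so they may be counted as
    well: the range no longer depends on the pattern, which makes counts in
    concatenated words comparable. *)
Lemma nu_count pi s : 0 < size pi -> nu pi s = count (occ pi s) (iota 0 (size s)).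
Proof.
move=> pi0; rewrite /nu -/(occ pi s).
have occ_out i : size s < i + size pi -> occ pi s i = false.
  by move=> h; apply/(occP _ _ _ pi0) => -[]; lia.
case: (posnP (size s)) => s0.
  by rewrite s0 sub0n /= -/(occ pi s 0) occ_out //; lia.
have [c e] : exists c, size s = (size s - size pi).+1 + c.
  by exists (size s - (size s - size pi).+1); lia.
rewrite [in RHS]e iotaD count_cat.
rewrite [X in _ = _ + X](_ : _ = 0) ?addn0 //.
apply/eqP; rewrite -leqn0 leqNgt -has_count; apply/hasPn => i.
by rewrite mem_iota => ii; rewrite occ_out //; lia.
Qed.

Lemma nu_cat pi u v : 0 < size pi -> nu pi u + nu pi v <= nu pi (u ++ v).
Proof.
move=> pi0; rewrite !nu_count // size_cat iotaD count_cat.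
apply: leq_add; last first.
  rewrite add0n -[in X in _ <= X](addn0 (size u)) iotaDl count_map.
  by apply: sub_count => i /=; rewrite /occ drop_cat ltnNge leq_addr /= addKn.
(* an occurrence in u does not reach into v *)
apply: (@leq_trans (count (predI (occ pi (u ++ v)) (fun i => i < size u)) (iota 0 (size u)))).
  apply: sub_count => i /(occP _ _ _ pi0)[iu h] /=.
  rewrite (_ : i < size u) ?andbT; last lia.
  apply/(occP _ _ _ pi0); rewrite size_cat; split; first lia.
  by move=> x y xl yl; rewrite !nth_cat !ifT ?h //; lia.
by apply: sub_count => i /andP[].
Qed.

(** * The maximal number of occurrences *)

Definition maxnu (pi : seq nat) (k n : nat) : nat :=
  \max_(s : n.-tuple 'I_k) nu pi (map val s).

Definition is_word (k n : nat) (w : seq nat) : bool :=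
  (size w == n) && all (fun x => x < k) w.

Lemma is_word_tuple k n (s : n.-tuple 'I_k) : is_word k n (map val s).
Proof.
rewrite /is_word size_map size_tuple eqxx /=.
by apply/allP => _ /mapP[x _ ->]; exact: ltn_ord.
Qed.

Lemma word_tuple k n w : is_word k n w -> exists s : n.-tuple 'I_k, w = map val s.
Proof.
elim: w n => [|x w IH] [|n] //; first by exists [tuple].
move=> /andP[sw /andP[xk aw]]; have [|s ->] := IH n; first exact/andP.
by exists [tuple of Ordinal xk :: s].
Qed.

Lemma nu_le_maxnu pi k n w : is_word k n w -> nu pi w <= maxnu pi k n.
Proof.
by move=> /word_tuple[s ->]; rewrite /maxnu (leq_bigmax s).
Qed.

Lemma maxnu_le pi k n B : (forall w, is_word k n w -> nu pi w <= B) ->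
  maxnu pi k n <= B.
Proof. by move=> h; apply/bigmax_leqP => s _; apply/h/is_word_tuple. Qed.

Lemma maxnu_attained pi k n : 0 < k ->
  exists2 w, is_word k n w & nu pi w = maxnu pi k n.
Proof.
case: k => // k _.
have [|s e] := @bigop.eq_bigmax (n.-tuple 'I_k.+1) (fun s => nu pi (map val s)).
  by rewrite card_tuple card_ord expn_gt0.
by exists (map val s); [exact: is_word_tuple | rewrite -e].
Qed.

Lemma maxnu_leq_alphabet pi k k' n : k <= k' -> maxnu pi k n <= maxnu pi k' n.
Proof.
move=> kk; apply: maxnu_le => w /andP[sw /allP aw]; apply: nu_le_maxnu.
by rewrite /is_word sw; apply/allP => x /aw xk; apply: leq_trans kk.
Qed.

Lemma nu_nil pi : 0 < size pi -> nu pi [::] = 0.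
Proof. by move=> pi0; rewrite nu_count. Qed.

Lemma maxnu_superadd pi k p q : 0 < size pi ->
  maxnu pi k p + maxnu pi k q <= maxnu pi k (p + q).
Proof.
move=> pi0; case: k => [|k].
  (* over the empty alphabet the only word is empty, so the maximum for a
     positive length is over no word at all *)
  have z n : maxnu pi 0 n = 0.
    apply/eqP; rewrite -leqn0; apply: maxnu_le => -[|x w]; first by rewrite nu_nil.
    by rewrite /is_word /= andbF.
  by rewrite !z.
have [u /andP[/eqP su au] <-] := maxnu_attained pi k.+1 p isT.
have [v /andP[/eqP sv av] <-] := maxnu_attained pi k.+1 q isT.
apply: leq_trans (nu_cat _ _ _ pi0) _; apply: nu_le_maxnu.
by rewrite /is_word size_cat su sv eqxx all_cat au av.
Qed.

(** Dividing the positions by M is injective on positions that are M apart. *)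
Lemma count_spaced (P : pred nat) M N : 0 < M ->
  (forall p q, P p -> P q -> p < q -> p + M <= q) ->
  count P (iota 0 N) * M <= N + M.
Proof.
move=> M0 gap; rewrite -size_filter.
set s := [seq x <- _ | _].
have sub : {subset map (divn^~ M) s <= iota 0 (N %/ M).+1}.
  move=> y /mapP[x]; rewrite mem_filter !mem_iota => /and3P[_ _ xN] ->.
  by rewrite /= add0n ltnS leq_div2r // ltnW.
have : size (map (divn^~ M) s) <= size (iota 0 (N %/ M).+1).
  apply: uniq_leq_size sub; rewrite map_inj_in_uniq ?filter_uniq ?iota_uniq //.
  have inj p q : P p -> P q -> p %/ M = q %/ M -> ~ p < q.
    move=> Pp Pq e pq; have : (p + M) %/ M <= q %/ M by rewrite leq_div2r ?gap.
    by rewrite divnDr // divnn M0 e; lia.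
  move=> p q; rewrite !mem_filter => /andP[Pp _] /andP[Pq _] /= e.
  by case: (ltngtP p q) => // [/(inj _ _ Pp Pq e)|/(inj _ _ Pq Pp (esym e))].
rewrite size_map size_iota => h; apply: leq_trans (leq_mul h (leqnn M)) _.
by rewrite mulSn addnC leq_add2r leq_divM.
Qed.

(** On the overlap both occurrences predict the ascents of the word. *)
Lemma occ_spaced l a s p q : 1 < l -> positive_upto l a ->
  occ (monotone_pattern l a) s p -> occ (monotone_pattern l a) s q -> p < q ->
  p + M_pattern l a <= q.
Proof.
move=> l1 ha.
have m0 := size_monotone_pattern_gt0 l a (ltnW l1) ha.
move=> /(occP _ _ _ m0)[_ hp] /(occP _ _ _ m0)[_ hq] pq.
rewrite size_monotone_pattern in hp hq.
suff : M_pattern l a <= q - p by lia.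
apply: M_pattern_le_shift => //; first lia.
move=> x xl; rewrite -!ascentP //; try lia.
rewrite -hp -?hq; try lia.
have -> : p + x.-1 = q + (x - (q - p)).-1 by lia.
by have -> : p + x = q + (x - (q - p)) by lia.
Qed.

Lemma maxnu_upper l a k n : 1 < l -> positive_upto l a ->
  maxnu (monotone_pattern l a) k n * M_pattern l a <= n + M_pattern l a.
Proof.
move=> l1 ha; have M0 := M_pattern_gt0 l a l1 ha.
have m0 := size_monotone_pattern_gt0 l a (ltnW l1) ha.
rewrite -leq_divRL //; apply: maxnu_le => w /andP[/eqP sw _].
rewrite leq_divRL // nu_count // sw; apply: count_spaced => // p q.
exact: occ_spaced.
Qed.

(** The pattern occurs where it begins inside run r+1 so as to end together
    with it after [a 1] letters; from there on its letters are those of the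
    word, lowered by r. *)
Lemma occ_in_runs l a b N r p w : 1 < l -> positive_upto l a ->
  a 1 <= b r.+1 -> (forall i, 2 <= i < l -> b (r + i) = a i) ->
  a l <= b (r + l) -> r + l <= N -> p + a 1 = psum b r.+1 ->
  p + psum a l <= size w -> w = take (size w) (monotone_pattern N b) ->
  occ (monotone_pattern l a) w p.
Proof.
move=> l1 ha b1 bi bl rN ep pw ew; have l0 := ltnW l1.
have m0 := size_monotone_pattern_gt0 l a (ltnW l1) ha.
have run i : 0 < i -> i < l -> psum b (r + i) = p + psum a i.
  elim: i => // -[|i] IH _ il; first by rewrite psum1 addn1 ep.
  have := psumS b (r + i.+1); have := psumS a i.+1.
  by rewrite -addnS (bi i.+2) ?IH //; lia.
have lt_run : p + psum a l <= psum b (r + l).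
  have := psumS b (r + l.-1); have := psumS a l.-1.
  by rewrite -addnS prednK // (run l.-1); lia.
have letter t : t < psum a l ->
    nth 0 w (p + t) = r + nth 0 (monotone_pattern l a) t.
  move=> tl; have [i [il h1 h2]] := psum_level _ _ _ tl.
  rewrite (nth_monotone_pattern _ _ i t) // ew nth_take; last lia.
  rewrite (nth_monotone_pattern _ _ (r + i)) ?addnS //; first lia.
    case: i il h1 {h2} => [|i] il h1; last by rewrite run //; lia.
    by rewrite addn0; move: ep; rewrite psumS; lia.
  have [il'|li] := ltnP i.+1 l.
    by rewrite -(addnS r i) run //; lia.
  have -> : (r + i).+1 = r + l by lia.
  by apply: leq_trans lt_run; rewrite ltn_add2l.
apply/(occP _ _ _ m0); rewrite size_monotone_pattern; split=> // i j il jl.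
by rewrite !letter // ltn_add2l.
Qed.

(** A nondecreasing word with periodic run lengths has an occurrence every M
    letters.  Its letter at position t is at most t+1, so n+1 letters suffice
    for length n. *)
Lemma maxnu_lower l a : 1 < l -> positive_upto l a -> exists C, forall k n, n < k ->
  n <= maxnu (monotone_pattern l a) k n * M_pattern l a + C.
Proof.
move=> l1 ha; have M0 := M_pattern_gt0 l a l1 ha.
have [b [j [[jl per b_pos] [b1 bi bl bM]]]] := periodic_runs l a l1 ha.
set M := M_pattern l a in M0 bM *.
have m0 := size_monotone_pattern_gt0 l a (ltnW l1) ha.
have b_posN N : positive_upto N b by [].
have perM s t : b (s * j + t) = b t.
  by elim: s => // s IH; rewrite mulSn -addnA addnC per.
have psumM s : psum b (s * j).+1 = s * M + b 1.
  have shift i : psum b (i + j) = psum b i + M.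
    elim: i => [|i IH]; first by rewrite psum0 bM.
    by rewrite addSn psumS IH -addSn per psumS addnAC.
  elim: s => [|s IH]; first by rewrite psum1.
  by rewrite mulSn addnC -addSn shift IH mulSn; lia.
exists (b 1 + psum a l + M) => k n nk.
(* enough runs to cover n letters and all the runs of the occurrences used *)
set N := n.+1 * l.
set w := take n (monotone_pattern N b).
have nN : n <= psum b N.
  by apply: leq_trans (psum_ge N b N (b_posN N) (leqnn N)); rewrite /N; nia.
have sw : size w = n by rewrite size_takel // size_monotone_pattern.
have word_w : is_word k n w.
  rewrite /is_word sw eqxx /=; apply/(all_nthP 0) => t; rewrite sw => tn.
  rewrite nth_take //.
  have [i [iN h1 h2]] := psum_level N b t (leq_trans tn nN).
  rewrite (nth_monotone_pattern _ _ i) //.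
  by have := psum_ge N b i (b_posN N) (ltnW iN); lia.
set q := (n - (b 1 + psum a l)) %/ M.
suff : q <= nu (monotone_pattern l a) w.
  move=> /leq_trans/(_ (nu_le_maxnu _ _ _ _ word_w)) h.
  have := leq_mul h (leqnn M).
  have := divn_eq (n - (b 1 + psum a l)) M; rewrite -/q.
  have := ltn_pmod (n - (b 1 + psum a l)) M0; lia.
pose pos s := b 1 - a 1 + s * M.
have occ_pos s : s < q -> pos s + psum a l <= n /\ occ (monotone_pattern l a) w (pos s).
  move=> sq.
  have le : pos s + psum a l <= n.
    have : s * M <= q * M by rewrite leq_mul // ltnW.
    have : q * M <= n - (b 1 + psum a l) by rewrite leq_divM.
    have : 0 < q * M by rewrite muln_gt0 M0 andbT; lia.
    rewrite /pos; lia.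
  split=> //; apply: (occ_in_runs l a b N (s * j)) => //.
  - by rewrite -(addn1 (s * j)) perM.
  - by move=> i il; rewrite perM bi.
  - by rewrite perM.
  - have : s <= n by move: le; rewrite /pos; nia.
    by rewrite /N; nia.
  - by rewrite psumM /pos; lia.
  - by rewrite sw.
  - by rewrite sw.
rewrite nu_count // sw -size_filter -(size_iota 0 q) -(size_map pos).
apply: uniq_leq_size.
  by rewrite map_inj_uniq ?iota_uniq // => x y; rewrite /pos; nia.
move=> p /mapP[s]; rewrite mem_iota => /occ_pos[le oc] ->.
rewrite mem_filter oc mem_iota /= add0n.
by rewrite size_monotone_pattern in m0; lia.
Qed.

(** * The limits *)

Local Open Scope ring_scope.
Local Open Scope classical_set_scope.

Lemma cvg_affine_ratio (R : realType) (c : R) (m : nat) :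
  (n%:R + c) / (n.+1 - m)%:R @[n --> \oo] --> (1 : R).
Proof.
rewrite -(cvg_shiftn m).
have -> : [sequence ((n + m)%N%:R + c) / ((n + m).+1 - m)%:R]_n =
          (fun n => 1 + (m%:R + c - 1) * (n.+1%:R)^-1) :> (nat -> R).
  apply/funext => n /=; rewrite -addSn addnK natrD.
  have : n.+1%:R != 0 :> R by rewrite pnatr_eq0.
  by rewrite -natr1 => n0; field.
have : 1 + (m%:R + c - 1) * n.+1%:R^-1 @[n --> \oo] --> 1 + (m%:R + c - 1) * (0 : R).
  apply: cvgD; first exact: cvg_cst.
  by apply: cvgM; [exact: cvg_cst | exact: cvg_harmonic].
by rewrite mulr0 addr0.
Qed.

(** Fekete's lemma for nonnegative superadditive sequences: the slope of u tends to
    its supremum, because cutting n into blocks of length N gives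
    [u n >= (n %/ N) * u N]. *)
Lemma fekete (R : realType) (u : nat -> R) (B : R) :
  (forall n, 0 <= u n) -> (forall p q, u p + u q <= u (p + q)%N) ->
  (forall n, (0 < n)%N -> u n <= B * n%:R) ->
  exists L, (u n / n%:R @[n --> \oo] --> L) /\
    forall n, (0 < n)%N -> u n / n%:R <= L.
Proof.
move=> u_ge0 u_add u_le.
pose E := [set x | exists2 n, (0 < n)%N & x = u n / n%:R].
have E_sup : has_sup E.
  split; first by exists (u 1 / 1%:R); exists 1.
  exists B => _ [n n0 ->]; rewrite ler_pdivrMr ?ltr0n //; exact: u_le.
have leL n : (0 < n)%N -> u n / n%:R <= sup E.
  by move=> n0; apply: ub_le_sup; [case: E_sup | exists n].
have u_mul q n : u n *+ q <= u (q * n)%N.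
  elim: q => [|q IH]; first by rewrite mulr0n.
  by rewrite mulrS mulSn; apply: le_trans (u_add _ _); rewrite lerD2l.
exists (sup E); split=> //.
apply/cvgrPdist_le => e e0.
have e2 : 0 < e / 2 by rewrite divr_gt0.
have [_ [N N0 ->] lt_N] := sup_adherent e2 E_sup.
set x := u N / N%:R in lt_N.
have x0 : 0 <= x by rewrite divr_ge0.
near=> n.
have nN : (N <= n)%N by near: n; exact: nbhs_infty_ge.
have nbig : N%:R * x / (e / 2) <= n%:R by near: n; exact: nbhs_infty_ger.
have n0 : (0 < n)%N by exact: leq_trans nN.
have n0' : 0 < n%:R :> R by rewrite ltr0n.
have N0' : 0 < N%:R :> R by rewrite ltr0n.
have h1 : n%:R * x - N%:R * x <= u n.
  have e1 := divn_eq n N.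
  have : u N *+ (n %/ N) <= u n.
    rewrite [in leRHS]e1; apply: le_trans (u_mul _ _) _.
    by apply: le_trans (u_add _ _); rewrite lerDl.
  apply: le_trans; rewrite -[u N *+ _]mulr_natl.
  have -> : u N = N%:R * x by rewrite /x mulrC divfK // gt_eqF.
  rewrite mulrA -mulrBl ler_wpM2r // lerBlDr -natrM -natrD ler_nat.
  by rewrite [in leqLHS]e1 leq_add2l ltnW // ltn_pmod.
have h2 := leL n n0.
rewrite ger0_norm ?subr_ge0 //.
rewrite ler_pdivrMr // in nbig.
suff : x - e / 2 <= u n / n%:R by lra.
rewrite ler_pdivlMr //; nra.
Unshelve. all: by end_near.
Qed.

(** Both iterated limits are squeezed between the same bounds.  When k goes first,
    monotonicity in k gives the inner limit.  When n goes first, the inner limit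
    is the supremum over n of [f k n / n] by superadditivity; taking n = k-1 in
    this supremum makes the lower bound, which asks for more letters than
    positions, available for a fixed alphabet as well. *)
Lemma iterated_density (R : realType) (f : nat -> nat -> nat) (m M C : nat) :
  (0 < M)%N ->
  (forall k k' n, (k <= k' -> f k n <= f k' n)%N) ->
  (forall k p q, (f k p + f k q <= f k (p + q))%N) ->
  (forall k n, (f k n * M <= n + M)%N) ->
  (forall k n, (n < k -> n <= f k n * M + C)%N) ->
  let u k n : R := (f k n)%:R / (n.+1 - m)%:R in
  [/\ iterated_cvg (fun n k => u k n), iterated_cvg u,
      iterated_lim (fun n k => u k n) = 1 / M%:R & iterated_lim u = 1 / M%:R].
Proof.
move=> M0 f_mono f_add f_up f_low u.
have M0' : 0 < M%:R :> R by rewrite ltr0n.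
have up k n : (f k n)%:R <= (n%:R + M%:R) / M%:R :> R.
  by rewrite ler_pdivlMr // -natrM -natrD ler_nat.
have low k n : (n < k)%N -> (n%:R - C%:R) / M%:R <= (f k n)%:R :> R.
  by move=> nk; rewrite ler_pdivrMr // lerBlDr -natrM -natrD ler_nat f_low.
have ratio_cvg (c : R) p : (n%:R + c) / M%:R / (n.+1 - p)%:R @[n --> \oo] --> (1 / M%:R : R).
  have -> : (fun n => (n%:R + c) / M%:R / (n.+1 - p)%:R) =
            (fun n => (n%:R + c) / (n.+1 - p)%:R * (M%:R)^-1).
    by apply/funext => n; rewrite mulrAC.
  by apply: cvgM; [exact: cvg_affine_ratio | exact: cvg_cst].
have den_ge0 n : 0 <= ((n.+1 - m)%:R : R)^-1 by rewrite invr_ge0.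
have cvg_k n : cvgn (u^~ n).
  apply: nondecreasing_is_cvgn.
    by move=> k k' kk; rewrite /u ler_wpM2r // ler_nat f_mono.
  exists ((n%:R + M%:R) / M%:R / (n.+1 - m)%:R) => _ [k _ <-].
  by rewrite /u ler_wpM2r.
have lim_k : limn (u^~ n) @[n --> \oo] --> (1 / M%:R : R).
  apply: squeeze_cvgr; [|exact: (ratio_cvg (- C%:R) m)|exact: (ratio_cvg M%:R m)].
  apply: nearW => n; apply/andP; split.
    apply: limr_ge (cvg_k n) _; near=> k.
    by rewrite /u ler_wpM2r // low //; near: k; exact: nbhs_infty_gt.
  by apply: limr_le (cvg_k n) _; apply: nearW => k; rewrite /u ler_wpM2r.
have fek k : exists L : R, ((f k n)%:R / n%:R @[n --> \oo] --> L) /\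
    forall n, (0 < n)%N -> (f k n)%:R / n%:R <= L.
  apply: (fekete _ (fun n => (f k n)%:R) M.+1%:R) => [n|p q|n n0].
  - exact: ler0n.
  - by rewrite -natrD ler_nat.
  - by rewrite -natrM ler_nat; have := f_up k n; nia.
have [L /all_and2[L_cvg L_ub]] := boolp.choice fek.
have u_cvg k : u k n @[n --> \oo] --> L k.
  rewrite -[L k]mulr1.
  apply: (cvg_trans _ (cvgM (L_cvg k) (cvg_affine_ratio R 0 m))).
  apply: near_eq_cvg; near=> n.
  have n0 : n%:R != 0 :> R.
    by rewrite pnatr_eq0 -lt0n; near: n; exact: nbhs_infty_gt.
  by rewrite /u /= addr0 mulrA divfK.
have L_le k : L k <= 1 / M%:R.
  apply: (ler_cvg_to (u_cvg k) (ratio_cvg M%:R m)).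
  by apply: nearW => n; rewrite /u ler_wpM2r.
have L_cvg1 : L n @[n --> \oo] --> (1 / M%:R : R).
  rewrite -(cvg_shiftn 1).
  apply: squeeze_cvgr; [|exact: (ratio_cvg (- C%:R) 1)|exact: cvg_cst].
  near=> n; rewrite L_le andbT /= subn1 /= addn1.
  have n0 : (0 < n)%N by near: n; exact: nbhs_infty_gt.
  apply: le_trans (L_ub n.+1 n n0); rewrite ler_wpM2r ?invr_ge0 //.
  exact: low.
have lim_u : (fun k => limn (u k)) = L.
  by apply/funext => k; apply: cvg_lim (u_cvg k).
split.
- by split=> //; apply/cvg_ex; exists (1 / M%:R).
- by split=> [k|]; [apply/cvg_ex; exists (L k) | rewrite lim_u; apply/cvg_ex; exists (1 / M%:R)].
- exact: cvg_lim lim_k.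
- by rewrite /iterated_lim lim_u; exact: cvg_lim L_cvg1.
Unshelve. all: by end_near.
Qed.

Theorem theorem3p3 (R : realType) (l : nat) (a : nat -> nat)
    (hl : (1 < l)%N)
    (ha : forall i : nat, (1 <= i <= l)%N -> (1 <= a i)%N) :
  [/\ delta_exists R (monotone_pattern l a),
      delta'_exists R (monotone_pattern l a),
      delta R (monotone_pattern l a) = 1 / (M_pattern l a)%:R
    & delta' R (monotone_pattern l a) = 1 / (M_pattern l a)%:R].
Proof.
have [C low] := maxnu_lower l a hl ha.
apply: (iterated_density R (maxnu (monotone_pattern l a)) _ _ C).
- exact: M_pattern_gt0.
- by move=> k k' n; exact: maxnu_leq_alphabet.
- move=> k p q; apply: maxnu_superadd.
  exact: (size_monotone_pattern_gt0 l a (ltnW hl) ha).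
- by move=> k n; exact: maxnu_upper.
- exact: low.
Qed.
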